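(* There is an absolute constant $C > 0$ such that for every $n \geq 2$ and every simple graph $G$ on $n$ vertices, $$\max\{\lambda(G), \lambda(\bar{G})\} \geq 1 - C\, n^{-1/3},$$ where $\bar{G}$ is the complement of $G$.
   Context: For a simple graph $G$ on $n$ vertices, $L(G) = D(G) - A(G)$ is its Laplacian matrix ($A(G)$ the adjacency matrix, $D(G)$ the diagonal degree matrix), with eigenvalues $0 = \lambda_1(G) \leq \lambda_2(G) \leq \cdots \leq \lambda_n(G)$. The algebraic connectivity is $\lambda(G) := \lambda_2(G)$. The paper states the result as $\max\{\lambda(G), \lambda(\bar{G})\} \geq 1 - O(n^{-1/3})$. *)

(* Defs.v *)
From HB Require Import structures.
From mathcomp Require Import all_boot all_order all_algebra.
From mathcomp Require Import boolp classical_sets reals Rstruct exp.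
Set Implicit Arguments. Unset Strict Implicit. Unset Printing Implicit Defensive.
Import Order.TTheory GRing.Theory Num.Theory.
Local Open Scope ring_scope.

Definition simple_graph (n : nat) (G : rel 'I_n) : Prop :=
  (forall i j, G i j = G j i) /\ (forall i, G i i = false).

Definition gcompl (n : nat) (G : rel 'I_n) : rel 'I_n :=
  fun i j => (i != j) && ~~ G i j.

Definition adjacency (R : nzRingType) (n : nat) (G : rel 'I_n) : 'M[R]_n :=
  \matrix_(i, j) (G i j)%:R.

Definition degree_mx (R : nzRingType) (n : nat) (G : rel 'I_n) : 'M[R]_n :=
  \matrix_(i, j) (if i == j then #|[set k | G i k]|%:R else 0).

Definition laplacian (R : nzRingType) (n : nat) (G : rel 'I_n) : 'M[R]_n :=
  degree_mx R G - adjacency R G.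

(* The eigenvalues of A, listed in nondecreasing order with multiplicity:
   the sorted sequence of roots of the characteristic polynomial (when the
   characteristic polynomial splits over R, which holds for real symmetric
   matrices; such a sorted sequence is then unique). *)
Definition spectrum (R : realType) (n : nat) (A : 'M[R]_n) : seq R :=
  match pselect (exists s : seq R, sorted <=%R s /\
                   char_poly A = \prod_(x <- s) ('X - x%:P)) with
  | left e => projT1 (cid e)
  | right _ => [::]
  end.

(* lambda_k(A), 1-indexed: k-th smallest eigenvalue. *)
Definition eigval (R : realType) (n : nat) (A : 'M[R]_n) (k : nat) : R :=
  nth 0 (spectrum A) k.-1.

Definition alg_conn (n : nat) (G : rel 'I_n) : Rdefinitions.R :=
  eigval (laplacian Rdefinitions.R G) 2.

(* Main.v *)
(* Suppose lambda(G), lambda(compl G) < 1.  Unit zero-sum test vectors f, g have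
   edge energy at most lambda on G, resp. on its complement, and
     sum_(i,j) (f_i - f_j)^2 (g_i - g_j)^2 = 2 n S + 2 + 4 (f . g)^2,
   where S = sum_i f_i^2 g_i^2.  Every pair is an edge of G or of its complement,
   so the left side is at most 4 M times the total energy when all f_i^2, g_i^2
   are at most M.  Hence S = O(1/n) and some coordinate is bounded below, say
   g_v^2 >= 1/16; then v has O(1) non-neighbours in G and f_v^2 = O(1/n).
   Let e = n^(-1/3) and A = {i : |f_i| <= e}.  If each non-neighbour of v outside A
   has a neighbour in A, these edges together with the edges at v force the energy
   of f to be 1 - O(e).  Otherwise some j is joined to all of A in the complement;
   outside A the mass of g is at most S / e^2 = O(e), so the star from j to A
   forces the energy of g to be 1 - O(e). *)

Require Import Defs.
From HB Require Import structures.
From mathcomp Require Import all_boot all_order all_algebra.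
From mathcomp Require Import boolp classical_sets reals Rstruct exp.
From mathcomp Require Import complex spectral sesquilinear ring lra.
Import Order.TTheory GRing.Theory Num.Theory.
Local Open Scope ring_scope.
Local Open Scope sesquilinear_scope.

(** * Spectral theorem and min-max for real symmetric matrices *)

Lemma char_poly_similar (F : comUnitRingType) (n : nat) (P A B : 'M[F]_n) :
  P \in unitmx -> A = invmx P *m B *m P -> char_poly A = char_poly B.
Proof.
move=> Pu ->; rewrite /char_poly.
suff -> : char_poly_mx (invmx P *m B *m P) =
  map_mx polyC (invmx P) *m char_poly_mx B *m map_mx polyC P.
  rewrite !det_mulmx mulrAC -det_mulmx -map_mxM mulVmx// map_mx1 det1 mul1r //.
rewrite /char_poly_mx mulmxBr mulmxBl !map_mxM; congr (_ - _).
by rewrite -mulmxA -scalar_mxC mulmxA -map_mxM mulVmx// map_mx1 mul1mx.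
Qed.

(** The matrix is diagonalized as a Hermitian matrix over [R[i]]. Its eigenvalues are real, so the
    factorization of the characteristic polynomial descends to [R], and [spectrum A] does not fall
    into its default branch. *)
Lemma symmetric_map_complex_spectral (R : realType) (n : nat) (A : 'M[R]_n) :
  A^T = A ->
  exists (P : 'M[R[i]]_n) (d : 'I_n -> R),
    [/\ P \is unitarymx,
        map_mx (real_complex R) A =
          P ^t* *m diag_mx (\row_j (d j)%:C%C) *m P &
        sorted <=%R (spectrum A) /\ perm_eq (spectrum A) [seq d j | j <- enum 'I_n]].
Proof.
move=> symA; set AC := map_mx _ A.
have ACh : AC \is hermsymmx.
  apply: realsym_hermsym.
    apply/is_hermitianmxP; rewrite expr0 scale1r map_mx_id//.
    by apply/matrixP => i j; rewrite !mxE -[in LHS]symA mxE.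
  by apply/mxOverP => i j; rewrite mxE complex_real.
have /orthomx_spectralP AE := hermitian_normalmx ACh.
have /mxOverP dr := hermitian_spectral_diag_real ACh.
set P := spectralmx AC in AE *; set D := spectral_diag AC in AE dr *.
have Pu : P \is unitarymx := spectral_unitarymx _.
have DE : D = \row_j (complex.Re (D 0 j))%:C%C.
  by apply/rowP => j; rewrite mxE RRe_real.
exists P, (fun j => complex.Re (D 0 j)); split => //.
  by rewrite -invmx_unitary// -DE.
have charA : char_poly A = \prod_(x <- [seq complex.Re (D 0 j) | j <- enum 'I_n]) ('X - x%:P).
  apply: (map_inj_poly (@complexI R)); first by rewrite raddf0.
  rewrite map_char_poly -/AC (char_poly_similar _ _ P _ _ _ AE) ?unitarymx_unit//.
  rewrite char_poly_trig ?diag_mx_is_trig// big_map big_enum rmorph_prod/=.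
  apply: eq_bigr => j _; rewrite rmorphB/= map_polyX map_polyC/=.
  by rewrite RRe_real// mxE eqxx.
rewrite /spectrum; case: pselect => [e|[]].
  case: (cid e) => s [ss sE] /=; split=> //; apply: prod_XsubC_eq.
  by rewrite -sE charA.
exists (sort <=%R [seq complex.Re (D 0 j) | j <- enum 'I_n]); split.
  exact/sort_sorted/le_total.
by rewrite charA; apply/perm_big; rewrite perm_sym perm_sort.
Qed.

(** At least two entries of [s] are at most the second one. Counting indices rather than values
    covers a repeated eigenvalue. *)
Lemma sorted_perm_two_le (R : realDomainType) (n : nat) (d : 'I_n -> R) (s : seq R) :
  (1 < n)%N -> sorted <=%R s -> perm_eq s [seq d j | j <- enum 'I_n] ->
  exists i j : 'I_n, [/\ i != j, d i <= nth 0 s 1 & d j <= nth 0 s 1].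
Proof.
move=> n_gt1 ss ps; set t := nth 0 s 1.
have sz : size s = n by rewrite (perm_size ps) size_map size_enum_ord.
suff : (1 < #|[pred j | d j <= t]%R|)%N.
  by move=> /card_gt1P[i [j [+ + ij]]]; rewrite !inE; exists i, j.
have -> : #|[pred j | d j <= t]%R| = count (<= t)%R s.
  rewrite (permP ps) count_map cardE size_filter -enumT/=; exact: eq_count.
rewrite /t; case: s ss sz {ps t} => [|a [|b s]] //=; try by move=> _ e; rewrite -e in n_gt1.
by move=> /andP[ab _] _; rewrite ab lexx.
Qed.

(** With z = x + i y, the cross terms are i (y A x^T - x A y^T), which is purely imaginary. *)
Lemma Re_hermitian_form (R : rcfType) (n : nat) (A : 'M[R]_n) (z : 'rV[R[i]]_n) :
  complex.Re ((z *m map_mx (real_complex R) A *m z ^t* ) 0 0) =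
  (map_mx (@complex.Re R) z *m A *m (map_mx (@complex.Re R) z)^T) 0 0 +
  (map_mx (@complex.Im R) z *m A *m (map_mx (@complex.Im R) z)^T) 0 0.
Proof.
rewrite !mxE raddf_sum -big_split/=; apply: eq_bigr => k _.
rewrite !mxE !mulr_suml raddf_sum -big_split/=; apply: eq_bigr => l _.
rewrite !mxE/=; case: (z 0 l) (z 0 k) => [a b] [c e] /=.
ring.
Qed.

(* Min-max: a combination of two eigenvectors for the two smallest eigenvalues is
   orthogonal to [w]; its real or its imaginary part is the required vector. *)
Lemma eigval2_test_vector (R : realType) (n : nat) (A : 'M[R]_n) (w : 'cV[R]_n) :
  (1 < n)%N -> A^T = A ->
  exists f : 'rV[R]_n, [/\ f != 0, f *m w = 0 &
    (f *m A *m f^T) 0 0 <= eigval A 2 * (f *m f^T) 0 0].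
Proof.
move=> n_gt1 /symmetric_map_complex_spectral[P [d [Pu AE [ss ps]]]].
have [i [j [ij di dj]]] := sorted_perm_two_le _ _ _ _ n_gt1 ss ps.
rewrite -[nth _ _ _]/(eigval A 2) in di dj; set t := eigval A 2 in di dj *.
pose W := P *m map_mx (real_complex R) w.
(* In eigenbasis coordinates this is one linear condition on the plane of coordinates [i] and [j]:
   e_i solves it if W_i = 0, and W_j e_i - W_i e_j otherwise. *)
have [c [c0 cW csupp]] : exists c : 'rV[R[i]]_n, [/\ c != 0, c *m W = 0 &
    forall k, c 0 k != 0 -> d k <= t].
  have [Wi0|Wi0] := eqVneq (W i 0) 0.
    exists (delta_mx 0 i); split.
    - apply/negP => /eqP/rowP/(_ i)/eqP; rewrite !mxE !eqxx/= oner_eq0 //.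
    - by rewrite -rowE; apply/rowP => k; rewrite ord1 mxE Wi0 mxE.
    - by move=> k; rewrite mxE eqxx/=; have [->//|_] := eqVneq k i; rewrite eqxx.
  have [a aE] : exists a, W i 0 = a by exists (W i 0).
  have [b bE] : exists b, W j 0 = b by exists (W j 0).
  exists (b *: delta_mx 0 i - a *: delta_mx 0 j); split.
  - apply/negP => /eqP/rowP/(_ j)/eqP; rewrite !mxE !eqxx/= (eq_sym j) (negbTE ij).
    by rewrite mulr0 mulr1 sub0r oppr_eq0 -aE (negbTE Wi0).
  - rewrite mulmxBl -!scalemxAl -!rowE; apply/rowP => k.
    by rewrite ord1 mxE [X in X + _]mxE [X in _ + X]mxE [X in _ - X]mxE
      ![(row _ _) _ _]mxE aE bE mulrC subrr mxE.
  - move=> k; rewrite !mxE eqxx/=; have [->//|_] := eqVneq k i.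
    by have [->//|_] := eqVneq k j; rewrite !mulr0 subr0 eqxx.
pose z := c *m P.
have zw : z *m map_mx (real_complex R) w = 0 by rewrite -mulmxA.
have zN0 : z != 0.
  by apply: contra_neq c0 => z0; rewrite -(mulmxK (unitarymx_unit Pu) c) -/z z0 mul0mx.
have PP : P *m P ^t* = 1%:M by apply/unitarymxP.
(* Used with [B] the diagonal matrix and with the identity: form and norm of [z] become sums over
   the coordinates of [c]. *)
have zE (B : 'M[R[i]]_n) : z *m (P^t* *m B *m P) *m z ^t* = c *m B *m c^t*.
  rewrite /z trmx_mul map_mxM !mulmxA -(mulmxA c) PP mulmx1.
  by rewrite -!mulmxA (mulmxA P) PP mul1mx.
have := congr1 (fun M : 'M[R[i]]_1 => complex.Re (M 0 0))
  (zE (map_mx (real_complex R) (diag_mx (\row_k d k)))).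
have -> : P ^t* *m map_mx (real_complex R) (diag_mx (\row_k d k)) *m P =
    map_mx (real_complex R) A.
  by rewrite AE map_diag_mx; congr (_ *m diag_mx _ *m _); apply/rowP => k; rewrite !mxE.
have := congr1 (fun M : 'M[R[i]]_1 => complex.Re (M 0 0))
  (zE (map_mx (real_complex R) 1%:M)).
have -> : P ^t* *m map_mx (real_complex R) 1%:M *m P = map_mx (real_complex R) 1%:M.
  by rewrite !map_mx1 mulmx1 -(invmx_unitary Pu) mulVmx ?unitarymx_unit.
rewrite !Re_hermitian_form !mulmx1.
set x := map_mx _ z; set y := map_mx _ z; set p := map_mx _ c; set q := map_mx _ c.
move=> normE formE; clear zE; clearbody z.
have sumD (u : 'rV[R]_n) : (u *m diag_mx (\row_k d k) *m u^T) 0 0 = \sum_k d k * u 0 k ^+ 2.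
  rewrite mul_mx_diag mxE; apply: eq_bigr => k _.
  by rewrite !mxE mulrAC mulrC expr2.
have sum1 (u : 'rV[R]_n) : (u *m u^T) 0 0 = \sum_k u 0 k ^+ 2.
  by rewrite mxE; apply: eq_bigr => k _; rewrite mxE expr2.
have le : (x *m A *m x^T) 0 0 + (y *m A *m y^T) 0 0 <= t * ((x *m x^T) 0 0 + (y *m y^T) 0 0).
  rewrite normE formE !sumD !sum1 -!big_split mulr_sumr/=; apply: ler_sum => k _.
  have [ck|ck] := eqVneq (c 0 k) 0; first by rewrite !mxE ck /= expr0n/= !mulr0 addr0 mulr0.
  rewrite -mulrDr ler_wpM2r ?csupp//; by rewrite addr_ge0 ?sqr_ge0.
have xw : x *m w = 0.
  apply/matrixP => k l; have /matrixP/(_ k l) := zw; rewrite !mxE => /(congr1 (@complex.Re R)).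
  rewrite raddf_sum/= => zE0; rewrite -[RHS]zE0; apply: eq_bigr => m _; rewrite !mxE/=.
  by case: (z k m) => ? ? /=; rewrite mulr0 subr0.
have yw : y *m w = 0.
  apply/matrixP => k l; have /matrixP/(_ k l) := zw; rewrite !mxE => /(congr1 (@complex.Im R)).
  rewrite raddf_sum/= => zE0; rewrite -[RHS]zE0; apply: eq_bigr => m _; rewrite !mxE/=.
  by case: (z k m) => ? ? /=; rewrite mulr0 add0r.
(* The inequality holds for the real and imaginary parts added together, hence for one of them. A
   zero [x] satisfies it trivially, so that case passes to [y]. *)
have [lex|gtx] := leP ((x *m A *m x^T) 0 0) (t * (x *m x^T) 0 0).
  have [x0|x0] := eqVneq x 0; last by exists x.
  exists y; split=> //.
    apply: contra_neq zN0 => y0; apply/rowP => k; rewrite mxE.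
    have /rowP/(_ k) := x0; have /rowP/(_ k) := y0; rewrite !mxE.
    by case: (z 0 k) => ? ? /= -> ->.
  by move: le; rewrite x0 !mul0mx !mxE !add0r.
exists y; split=> //; last by lra.
apply/negP => /eqP y0; move: le.
have -> : (y *m A *m y^T) 0 0 = 0 by rewrite y0 !mul0mx mxE.
have -> : (y *m y^T) 0 0 = 0 by rewrite y0 !mul0mx mxE.
by rewrite !addr0 leNgt gtx.
Qed.

(** * Edge energy *)

(* Edges are summed over ordered pairs: for a simple graph this is twice the
   Laplacian quadratic form. *)
Definition energy (R : pzRingType) (T : finType) (E : rel T) (f : T -> R) : R :=
  \sum_i \sum_(j | E i j) (f i - f j) ^+ 2.

Arguments energy {R T}.

Lemma energy_ge0 (R : realDomainType) (T : finType) (E : rel T) (f : T -> R) :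
  0 <= energy E f.
Proof. by apply: sumr_ge0 => i _; apply: sumr_ge0 => j _; apply: sqr_ge0. Qed.

(* [P] selects an orientation of some edges, so that each is counted once. *)
Lemma energy_ge_oriented (R : realDomainType) (T : finType) (E P : rel T) (f : T -> R) :
  symmetric E -> subrel P E -> (forall i j, P i j -> ~~ P j i) ->
  (\sum_i \sum_(j | P i j) (f i - f j) ^+ 2) *+ 2 <= energy E f.
Proof.
move=> symE PE aP; rewrite mulr2n.
under [X in X + _]eq_bigr do rewrite big_mkcond/=.
under [X in _ + X]eq_bigr do rewrite big_mkcond/=.
rewrite [X in _ + X]exchange_big -big_split/= /energy; apply: ler_sum => i _.
rewrite -big_split big_mkcond [leRHS]big_mkcond/=; apply: ler_sum => j _.
case: ifP => Pij.
  by rewrite (PE _ _ Pij) (negbTE (aP _ _ Pij)) addr0.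
case: ifP => Pji; rewrite add0r; last by case: ifP => _; rewrite ?sqr_ge0.
by rewrite symE (PE _ _ Pji) -sqrrN opprB.
Qed.

(** * The product identity and its consequences *)

Lemma sum_sqrB_mul_sqrB (R : comPzRingType) (T : finType) (f g : T -> R) :
  \sum_i f i = 0 -> \sum_i g i = 0 ->
  \sum_i f i ^+ 2 = 1 -> \sum_i g i ^+ 2 = 1 ->
  \sum_i \sum_j (f i - f j) ^+ 2 * (g i - g j) ^+ 2 =
  #|T|%:R * (\sum_i f i ^+ 2 * g i ^+ 2) *+ 2 + 2 + (\sum_i f i * g i) ^+ 2 *+ 4.
Proof.
move=> f0 g0 f1 g1.
set S := \sum_i f i ^+ 2 * g i ^+ 2; set c := \sum_i f i * g i.
(* These mixed moments enter a row only as multiples of [f i] or [g i], so the outer sum kills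
   them. *)
pose q := \sum_i f i * g i ^+ 2; pose r := \sum_i f i ^+ 2 * g i.
have rowE i : \sum_j (f i - f j) ^+ 2 * (g i - g j) ^+ 2 =
  #|T|%:R * (f i ^+ 2 * g i ^+ 2) + f i ^+ 2 + (4 * c) * (f i * g i) + (- 2 * q) * f i
   + g i ^+ 2 + (-2 * r) * g i + S.
  transitivity (\sum_j (f i ^+ 2 * g i ^+ 2 * 1 + (- 2 * f i ^+ 2 * g i) * g j
    + f i ^+ 2 * g j ^+ 2 + (- 2 * f i * g i ^+ 2) * f j + (4 * f i * g i) * (f j * g j)
    + (- 2 * f i) * (f j * g j ^+ 2) + g i ^+ 2 * f j ^+ 2
    + (- 2 * g i) * (f j ^+ 2 * g j) + f j ^+ 2 * g j ^+ 2)).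
    by apply: eq_bigr => j _; ring.
  rewrite !big_split/= -!mulr_sumr f0 g0 f1 g1 -/S -/c -/q -/r.
  by rewrite sumr_const -[#|_|]/#|T|; ring.
under eq_bigr do rewrite rowE.
rewrite !big_split/= -!mulr_sumr f0 g0 f1 g1 -/S -/c.
by rewrite sumr_const -[#|_|]/#|T| -mulr_natl; ring.
Qed.

Lemma sqrB_le4 (R : realDomainType) (M x y : R) :
  x ^+ 2 <= M -> y ^+ 2 <= M -> (x - y) ^+ 2 <= M *+ 4.
Proof. have := sqr_ge0 (x + y); nra. Qed.

(** On a pair in [E] the [g] factor is bounded by 4 M, on a pair in [F] the [f] factor; the diagonal
    contributes nothing. *)
Lemma product_energy_le (R : realDomainType) (T : finType) (E F : rel T)
    (f g : T -> R) (M : R) :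
  (forall i j, i != j -> F i j = ~~ E i j) ->
  (forall i, f i ^+ 2 <= M) -> (forall i, g i ^+ 2 <= M) ->
  \sum_i \sum_j (f i - f j) ^+ 2 * (g i - g j) ^+ 2 <=
  M *+ 4 * (energy E f + energy F g).
Proof.
move=> FE fM gM; rewrite /energy -big_split mulr_sumr/=; apply: ler_sum => i _.
rewrite [X in _ * (X + _)]big_mkcond [X in _ * (_ + X)]big_mkcond -big_split mulr_sumr/=.
apply: ler_sum => j _.
have M4 : 0 <= M *+ 4 by rewrite mulrn_wge0// (le_trans _ (fM i)) ?sqr_ge0.
have [->|ij] := eqVneq i j.
  by rewrite !subrr !expr0n/= mul0r !if_same addr0 mulr0.
rewrite FE//; case: (E i j); rewrite /= ?addr0 ?add0r.
  by rewrite mulrC ler_wpM2r ?sqr_ge0// sqrB_le4.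
by rewrite ler_wpM2r ?sqr_ge0// sqrB_le4.
Qed.

Lemma sum_sqr_mul_sqr_le (R : realDomainType) (T : finType) (E F : rel T) (f g : T -> R) :
  (forall i j, i != j -> F i j = ~~ E i j) ->
  \sum_i f i = 0 -> \sum_i g i = 0 ->
  \sum_i f i ^+ 2 = 1 -> \sum_i g i ^+ 2 = 1 ->
  energy E f <= 2 -> energy F g <= 2 ->
  #|T|%:R * (\sum_i f i ^+ 2 * g i ^+ 2) <= 7.
Proof.
move=> FE f0 g0 f1 g1 Ef Fg.
have le1 (h : T -> R) : \sum_i h i ^+ 2 = 1 -> forall i, h i ^+ 2 <= 1.
  by move=> <- i; rewrite (bigD1 i)//= lerDl sumr_ge0// => j _; apply: sqr_ge0.
(* With M = 1 the product sum is at most 4 (2 + 2) = 16; removing the constant 2 leaves 14, twice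
   the bound. *)
have := product_energy_le _ _ _ _ _ _ 1 FE (le1 _ f1) (le1 _ g1).
rewrite sum_sqrB_mul_sqrB//; have := sqr_ge0 (\sum_i f i * g i).
lra.
Qed.

Lemma exists_large_coordinate (R : realFieldType) (T : finType) (E F : rel T) (f g : T -> R) :
  (forall i j, i != j -> F i j = ~~ E i j) ->
  \sum_i f i = 0 -> \sum_i g i = 0 ->
  \sum_i f i ^+ 2 = 1 -> \sum_i g i ^+ 2 = 1 ->
  energy E f <= 2 -> energy F g <= 2 ->
  exists v, 16^-1 <= f v ^+ 2 \/ 16^-1 <= g v ^+ 2.
Proof.
move=> FE f0 g0 f1 g1 Ef Fg.
have [/existsP[v /orP]|/existsPn small] :=
  boolP [exists v, (16^-1 <= f v ^+ 2) || (16^-1 <= g v ^+ 2)]; first by exists v.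
have fM i : f i ^+ 2 <= 16^-1 by have := small i; rewrite negb_or -!ltNge => /andP[/ltW].
have gM i : g i ^+ 2 <= 16^-1 by have := small i; rewrite negb_or -!ltNge => /andP[_ /ltW].
(* With M = 1/16 the right side is at most 1, below the constant term 2 of the identity. *)
have := product_energy_le _ _ _ _ _ _ _ FE fM gM.
rewrite sum_sqrB_mul_sqrB//; have := sqr_ge0 (\sum_i f i * g i).
have S0 : 0 <= #|T|%:R * \sum_i f i ^+ 2 * g i ^+ 2.
  by rewrite mulr_ge0// sumr_ge0// => i _; rewrite mulr_ge0 ?sqr_ge0.
lra.
Qed.

(** Each [F]-neighbour j of [v] has 1/16 <= 2 (g_v - g_j)^2 + 2 g_j^2. Summed over these j, both
    squares give at most 1, so |F v| / 16 <= 4. *)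
Lemma card_nonadjacent_le (R : realFieldType) (T : finType) (F : rel T) (g : T -> R) (v : T) :
  symmetric F -> irreflexive F -> \sum_i g i ^+ 2 = 1 -> energy F g <= 2 ->
  16^-1 <= g v ^+ 2 -> (#|F v| <= 64)%N.
Proof.
move=> symF irrF g1 Fg gv.
have row : \sum_(j | F v j) (g v - g j) ^+ 2 <= 1.
  pose P i j := (i == v) && F v j.
  have : (\sum_i \sum_(j | P i j) (g i - g j) ^+ 2) *+ 2 <= energy F g.
    apply: energy_ge_oriented => //.
      by move=> i j /andP[/eqP->].
    move=> i j /andP[/eqP-> Fvj]; apply/negP => /andP[/eqP jv _].
    by rewrite jv irrF in Fvj.
  rewrite (bigD1 v)//= [X in _ + X]big1 => [|i /negbTE iv]; last first.
    by apply: big_pred0 => j; rewrite /P iv.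
  rewrite (eq_bigl (F v)) => [|j]; last by rewrite /P eqxx.
  lra.
have col : \sum_(j | F v j) g j ^+ 2 <= 1.
  rewrite -g1 [leRHS](bigID (F v))/= lerDl sumr_ge0// => j _; exact: sqr_ge0.
have : \sum_(j | F v j) (16^-1 : R) <= \sum_(j | F v j) ((g v - g j) ^+ 2 *+ 2 + g j ^+ 2 *+ 2).
  apply: ler_sum => j _; apply: le_trans gv _.
  have := sqr_ge0 (g v - g j - g j); nra.
rewrite big_split/= !sumrMnl sumr_const -[#|_|]/#|F v| -mulr_natl => le4.
by rewrite -(ler_nat R); lra.
Qed.

(** * Lower bounds on the energy from stars *)

(** Put h = g_j0 and B = [~: A]. Since [g] sums to zero, the star from [j0] to [A] has energy |A|
    h^2 + 2 h sum_B g + 1 - sum_B g^2, which is at least 1 - 2 sum_B g^2 when |B| <= |A|. *)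
Lemma isolated_energy_ge (R : realDomainType) (T : finType) (F : rel T) (g : T -> R)
    (A : {set T}) (j0 : T) (b : R) :
  symmetric F -> j0 \notin A -> (forall i, i \in A -> F j0 i) ->
  \sum_i g i = 0 -> \sum_i g i ^+ 2 = 1 ->
  (#|~: A| <= #|A|)%N -> \sum_(i in ~: A) g i ^+ 2 <= b ->
  2 - 4 * b <= energy F g.
Proof.
move=> symF j0A AF g0 g1 BA gB.
pose P i j := (i == j0) && (j \in A).
have : (\sum_i \sum_(j | P i j) (g i - g j) ^+ 2) *+ 2 <= energy F g.
  apply: energy_ge_oriented => //.
    by move=> i j /andP[/eqP-> /AF].
  move=> i j /andP[/eqP-> jA]; apply/negP => /andP[/eqP jv _].
  by rewrite -jv jA in j0A.
rewrite (bigD1 j0)//= [X in _ + X]big1 => [|i /negbTE iv]; last first.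
  by apply: big_pred0 => j; rewrite /P iv.
rewrite (eq_bigl (mem A)) => [|j]; last by rewrite /P eqxx.
set h := g j0.
have -> : \sum_(j in A) (h - g j) ^+ 2 =
    #|A|%:R * h ^+ 2 - 2 * h * (\sum_(j in A) g j) + \sum_(j in A) g j ^+ 2.
  transitivity (\sum_(j in A) (h ^+ 2 + (- 2 * h) * g j + g j ^+ 2)).
    by apply: eq_bigr => j _; ring.
  by rewrite !big_split/= -!mulr_sumr sumr_const -mulr_natl; ring.
have split (k : T -> R) : \sum_i k i = \sum_(i in A) k i + \sum_(i in ~: A) k i.
  rewrite (bigID (mem A))/=; congr (_ + _); apply: eq_bigl => i; by rewrite inE.
have := split g; have := split (fun i => g i ^+ 2); rewrite /= g0 g1 => sA2 sA.
(* [2 h g_i >= - (h^2 + g_i^2)] outside [A]; since [~: A] is no larger than [A],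
   the [h^2] terms are absorbed by those of [A]. *)
have amgm : 0 <= #|~: A|%:R * h ^+ 2 + 2 * h * (\sum_(i in ~: A) g i) + \sum_(i in ~: A) g i ^+ 2.
  have -> : #|~: A|%:R * h ^+ 2 + 2 * h * (\sum_(i in ~: A) g i) + \sum_(i in ~: A) g i ^+ 2
    = \sum_(i in ~: A) (h + g i) ^+ 2.
    transitivity (\sum_(j in ~: A) (h ^+ 2 + (2 * h) * g j + g j ^+ 2)).
      by rewrite !big_split/= -!mulr_sumr sumr_const -mulr_natl; ring.
    by apply: eq_bigr => j _; ring.
  by apply: sumr_ge0 => i _; apply: sqr_ge0.
have : #|~: A|%:R * h ^+ 2 <= #|A|%:R * h ^+ 2 by rewrite ler_wpM2r ?sqr_ge0// ler_nat.
have -> : \sum_(i in A) g i = - \sum_(i in ~: A) g i by lra.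
move: amgm gB; rewrite mulrN; lra.
Qed.

(** The full star at [v] has energy n f_v^2 + 1 >= 1. A missing pair (v, i) costs at most t^2 if i
    is in [A]; otherwise an edge from i to a point of [A], where [f] is within [t] of f_v, replaces
    it at a cost of at most 4 t, as differences of [f] are at most 2. *)
Lemma attached_energy_ge (R : realFieldType) (T : finType) (E F : rel T) (f : T -> R)
    (A : {set T}) (v : T) (t : R) :
  symmetric E -> irreflexive E -> irreflexive F ->
  (forall i j, i != j -> F i j = ~~ E i j) ->
  \sum_i f i = 0 -> \sum_i f i ^+ 2 = 1 ->
  (forall i, i \in A -> `|f i - f v| <= t) ->
  (forall j, F v j -> j \notin A -> exists2 i, i \in A & E j i) ->
  2 - (#|F v|%:R * (t ^+ 2 + 4 * t)) *+ 2 <= energy E f.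
Proof.
move=> symE irrE irrF FE f0 f1 fA att.
(* The default [j] is never reached where [r] matters, by [rP]. *)
pose r j := odflt j [pick i in A | E j i].
have rP j : F v j -> j \notin A -> (r j \in A) && E j (r j).
  move=> Fvj jA; have [i iA Eji] := att j Fvj jA; rewrite /r.
  by case: pickP => [//|/(_ i)]; rewrite iA Eji.
pose P i j := (i == v) && E v j || [&& F v i, i \notin A & j == r i].
have PE : subrel P E.
  move=> i j /orP[/andP[/eqP-> //]|/and3P[Fvi iA /eqP->]].
  by have /andP[] := rP _ Fvi iA.
have EF i : E v i -> F v i = false.
  move=> Evi; rewrite FE ?Evi//; by apply: contraTneq Evi => <-; rewrite irrE.
(* The replacement edges start at [F]-neighbours of [v] outside [A] and end in [A], so none is the
   reverse of another or of an edge of the star. *)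
have aP i j : P i j -> ~~ P j i.
  move=> Pij; have Eij := PE _ _ Pij; apply/negP => Pji; move: Pij Pji.
  move=> /orP[/andP[/eqP iv Evj]|/and3P[Fvi iA /eqP jr]].
    move=> /orP[/andP[/eqP jv _]|/and3P[Fvj _ _]]; first by rewrite jv irrE in Evj.
    by rewrite EF in Fvj.
  move=> /orP[/andP[/eqP jv Evi]|/and3P[Fvj jA _]]; first by rewrite EF in Fvi.
  by have /andP[rA _] := rP _ Fvi iA; rewrite jr rA in jA.
apply: le_trans (energy_ge_oriented _ _ _ _ _ symE PE aP).
rewrite (bigD1 v)//=.
have -> : \sum_(j | P v j) (f v - f j) ^+ 2 = \sum_(j | E v j) (f v - f j) ^+ 2.
  by apply: eq_bigl => j; rewrite /P eqxx irrF/= orbF.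
have -> : \sum_(i | i != v) \sum_(j | P i j) (f i - f j) ^+ 2 =
    \sum_(i | F v i) (if i \in A then 0 else (f i - f (r i)) ^+ 2).
  rewrite big_mkcond [RHS]big_mkcond; apply: eq_bigr => i _.
  have [->|iv] := eqVneq i v; first by rewrite irrF.
  rewrite /P (negbTE iv)/=; case: (F v i) => /=; last by rewrite big_pred0.
  case: (i \in A) => /=; first by rewrite big_pred0.
  by rewrite big_pred1_eq.
have tot : 1 <= \sum_(j | E v j) (f v - f j) ^+ 2 + \sum_(j | F v j) (f v - f j) ^+ 2.
  have -> : \sum_(j | E v j) (f v - f j) ^+ 2 + \sum_(j | F v j) (f v - f j) ^+ 2 =
      \sum_j (f v - f j) ^+ 2.
    rewrite [RHS](bigID (E v))/=; congr (_ + _).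
    rewrite big_mkcond [RHS]big_mkcond; apply: eq_bigr => j _.
    have [<-|vj] := eqVneq v j; first by rewrite irrF irrE subrr expr0n.
    by rewrite FE.
  have -> : \sum_j (f v - f j) ^+ 2 = \sum_j (f v ^+ 2 + (- 2 * f v) * f j + f j ^+ 2).
    by apply: eq_bigr => j _; ring.
  rewrite !big_split/= -[X in _ + X + _]mulr_sumr f0 f1 mulr0 addr0 lerDr sumr_ge0// => j _.
  exact: sqr_ge0.
have f2 i j : `|f i - f j| <= 2.
  have f_le k : `|f k| <= 1.
    rewrite -(expr_le1 (n := 2))// real_normK ?num_real// -f1 (bigD1 k)//= lerDl.
    by apply: sumr_ge0 => l _; apply: sqr_ge0.
  by rewrite (le_trans (ler_normB _ _))// -[2]/(1 + 1) lerD.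
have : \sum_(j | F v j) (f v - f j) ^+ 2 <=
    \sum_(i | F v i) ((if i \in A then 0 else (f i - f (r i)) ^+ 2) + (t ^+ 2 + 4 * t)).
  apply: ler_sum => i Fvi; case: ifPn => iA.
    have := fA _ iA; have := normr_ge0 (f i - f v); rewrite add0r -sqrrN opprB.
    rewrite -(real_normK (num_real (f i - f v))); nra.
  have /andP[rA _] := rP _ Fvi iA; have := f2 i v; have := fA _ rA.
  rewrite !ler_norml => /andP[? ?] /andP[? ?]; nra.
rewrite big_split/= sumr_const -[#|_|]/#|F v| -mulr_natl.
move: tot; lra.
Qed.

(** * The dichotomy at a vertex with a large coordinate *)

Lemma energy_dichotomy (R : realFieldType) (T : finType) (E F : rel T) (f g : T -> R)
    (v : T) (e : R) :
  symmetric E -> symmetric F -> irreflexive E -> irreflexive F ->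
  (forall i j, i != j -> F i j = ~~ E i j) ->
  \sum_i f i = 0 -> \sum_i g i = 0 ->
  \sum_i f i ^+ 2 = 1 -> \sum_i g i ^+ 2 = 1 ->
  energy E f <= 2 -> energy F g <= 2 ->
  16^-1 <= g v ^+ 2 -> 0 < e -> e ^+ 3 * #|T|%:R = 1 ->
  2 - 64 * 384 * e <= energy E f \/ 2 - 64 * 384 * e <= energy F g.
Proof.
move=> symE symF irrE irrF FE f0 g0 f1 g1 Ef Fg gv e0 en.
(* For large [e] the claimed bound is negative. *)
have [e2|e2] := leP 2^-1 e; first by left; have := energy_ge0 _ _ E f; lra.
have S7 := sum_sqr_mul_sqr_le _ _ _ _ _ _ FE f0 g0 f1 g1 Ef Fg.
set S := \sum_i f i ^+ 2 * g i ^+ 2 in S7.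
have e3 : 0 < e ^+ 3 by rewrite exprn_gt0.
have Se : S <= 7 * e ^+ 3.
  have -> : S = e ^+ 3 * (#|T|%:R * S) by rewrite mulrA en mul1r.
  by rewrite mulrC ler_wpM2r// ltW.
have fgS (B : pred T) : \sum_(i | B i) f i ^+ 2 * g i ^+ 2 <= S.
  rewrite /S [leRHS](bigID B)/= lerDl sumr_ge0// => i _.
  by rewrite mulr_ge0 ?sqr_ge0.
(* From g_v^2 >= 1/16: f_v^2 <= 16 S <= 112 e^3 <= 121 e^2. *)
have fv : f v ^+ 2 <= (11 * e) ^+ 2.
  have := fgS (pred1 v); rewrite big_pred1_eq; have := sqr_ge0 (f v).
  have e3E : e ^+ 3 = e * e ^+ 2 by rewrite exprS.
  have := sqr_ge0 e; nra.
pose A := [set i | `|f i| <= e].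
have [/existsP[j /and3P[Fvj jA /forallP noE]]|/existsPn att] :=
  boolP [exists j, [&& F v j, j \notin A & [forall i, (i \in A) ==> ~~ E j i]]].
  right.
  have fB i : i \in ~: A -> e ^+ 2 <= f i ^+ 2.
    rewrite !inE -ltNge => /ltW ef.
    by rewrite -(real_normK (num_real (f i))) lerXn2r// ?nnegrE ?normr_ge0// ltW.
  have gB : \sum_(i in ~: A) g i ^+ 2 <= 7 * e.
    have : e ^+ 2 * \sum_(i in ~: A) g i ^+ 2 <= S.
      rewrite mulr_sumr; apply: le_trans (fgS (mem (~: A))); apply: ler_sum => i iB.
      by rewrite ler_wpM2r ?sqr_ge0// fB.
    move=> /le_trans/(_ Se); have -> : 7 * e ^+ 3 = e ^+ 2 * (7 * e) by ring.
    by rewrite ler_pM2l// exprn_gt0.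
  (* Chebyshev: e^2 |~: A| <= 1 = e^3 n, so the complement of [A] has at most e n < n / 2 points. *)
  have cardB : (#|~: A| <= #|A|)%N.
    have : e ^+ 2 * #|~: A|%:R <= e ^+ 2 * (e * #|T|%:R).
      rewrite mulrA -exprSr en mulr_natr -sumr_const -[leRHS]f1 [leRHS](bigID (mem (~: A)))/=.
      rewrite -[leLHS]addr0 lerD//; first exact: ler_sum.
      by apply: sumr_ge0 => i _; apply: sqr_ge0.
    rewrite ler_pM2l ?exprn_gt0// => le1.
    have := cardsC A => cA; rewrite -(ler_nat R).
    have : (#|A| + #|~: A|)%:R = #|T|%:R :> R by rewrite cA.
    have : 0 <= #|T|%:R :> R by [].
    rewrite natrD; nra.
  have AF i : i \in A -> F j i.
    move=> iA; have := noE i; rewrite iA/= FE//.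
    by apply: contraNneq jA => ->.
  have := isolated_energy_ge _ _ _ _ _ _ _ symF jA AF g0 g1 cardB gB.
  lra.
left.
have fv' : `|f v| <= 11 * e.
  have e11 : 0 <= 11 * e by lra.
  by rewrite -ler_sqr ?nnegrE// real_normK ?num_real.
have fA i : i \in A -> `|f i - f v| <= 12 * e.
  rewrite inE => fi; rewrite (le_trans (ler_normB _ _))//; move: fi fv'; lra.
have attA j : F v j -> j \notin A -> exists2 i, i \in A & E j i.
  move=> Fvj jA; have := att j; rewrite Fvj jA/= negb_forall => /existsP[k].
  by rewrite negb_imply negbK => /andP[]; exists k.
apply: le_trans (attached_energy_ge _ _ _ _ _ _ _ _ symE irrE irrF FE f0 f1 fA attA).
have k64 := card_nonadjacent_le _ _ _ _ _ symF irrF g1 Fg gv.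
have {k64} : #|F v|%:R <= 64 :> R by rewrite ler_nat.
have : 0 <= #|F v|%:R :> R by [].
(* As e < 1, 144 e^2 + 48 e <= 192 e; at most 64 missing pairs, doubled, give 64 * 384 e. *)
have : (12 * e) ^+ 2 + 4 * (12 * e) <= 192 * e by nra.
have : 0 <= (12 * e) ^+ 2 + 4 * (12 * e) by rewrite addr_ge0 ?sqr_ge0 ?mulr_ge0// ltW.
move: ((12 * e) ^+ 2 + 4 * (12 * e)) (#|F v|%:R) => u k; nra.
Qed.

(** * From energy to algebraic connectivity *)

Lemma laplacian_formE (R : comNzRingType) (n : nat) (G : rel 'I_n) (f : 'rV[R]_n) :
  simple_graph G ->
  (f *m laplacian R G *m f^T) 0 0 *+ 2 = energy G (f 0).
Proof.
move=> [symG _].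
have degE i : #|[set k | G i k]|%:R = \sum_j (G i j)%:R :> R.
  by rewrite -sum1dep_card natr_sum big_mkcond; apply: eq_bigr => j _; case: (G i j).
have colE j : (f *m laplacian R G) 0 j = \sum_i (G i j)%:R * (f 0 j - f 0 i).
  rewrite mxE; under eq_bigr do rewrite !mxE mulrBr.
  rewrite sumrB (bigD1 j)//= eqxx big1 ?addr0 => [|i /negbTE ->]; last by rewrite mulr0.
  rewrite degE mulr_sumr -sumrB; apply: eq_bigr => i _.
  by rewrite symG mulrBr [f 0 j * _]mulrC [f 0 i * _]mulrC.
have -> : (f *m laplacian R G *m f^T) 0 0 =
    \sum_j \sum_i (G i j)%:R * (f 0 j - f 0 i) * f 0 j.
  by rewrite mxE; apply: eq_bigr => j _; rewrite colE mxE mulr_suml.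
rewrite mulr2n [X in X + _]exchange_big -big_split/=; apply: eq_bigr => i _.
rewrite -big_split [RHS]big_mkcond/=; apply: eq_bigr => j _.
by rewrite (symG j i); case: (G i j) => /=; ring.
Qed.

Lemma algebraic_connectivity_test_vector (R : realType) (n : nat) (G : rel 'I_n) :
  (1 < n)%N -> simple_graph G ->
  exists f : 'I_n -> R, [/\ \sum_i f i = 0, \sum_i f i ^+ 2 = 1 &
    energy G f <= 2 * eigval (laplacian R G) 2].
Proof.
move=> n_gt1 simpG.
have symL : (laplacian R G)^T = laplacian R G.
  apply/matrixP => i j; rewrite !mxE (proj1 simpG j i) eq_sym.
  by case: eqVneq => [->|].
(* Orthogonality to the all-ones vector makes the test vector zero-sum; it is then normalized. *)
have [f [f0 fw fL]] := eigval2_test_vector _ _ _ (const_mx 1) n_gt1 symL.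
have ffE : (f *m f^T) 0 0 = \sum_i f 0 i ^+ 2.
  by rewrite mxE; apply: eq_bigr => i _; rewrite mxE expr2.
have ff_gt0 : 0 < \sum_i f 0 i ^+ 2.
  rewrite lt_neqAle sumr_ge0 ?andbT => [|i _]; last exact: sqr_ge0.
  apply: contra_neq f0 => /esym /eqP; rewrite psumr_eq0 => [/allP ff0|i _]; last exact: sqr_ge0.
  apply/rowP => i; rewrite mxE; have := ff0 i (mem_index_enum _).
  by rewrite sqrf_eq0 => /eqP.
pose c := Num.sqrt (\sum_i f 0 i ^+ 2).
have c2 : c ^+ 2 = \sum_i f 0 i ^+ 2 by rewrite sqr_sqrtr// ltW.
have cN0 : c ^+ 2 != 0 by rewrite c2 gt_eqF.
exists (fun i => f 0 i / c); split.
- rewrite -mulr_suml; have /matrixP/(_ 0 0) := fw; rewrite !mxE.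
  under eq_bigr do rewrite mxE mulr1.
  by move=> ->; rewrite mul0r.
- under eq_bigr do rewrite expr_div_n.
  by rewrite -mulr_suml -c2 divff.
have -> : energy G (fun i => f 0 i / c) = energy G (f 0) / c ^+ 2.
  rewrite /energy mulr_suml; apply: eq_bigr => i _; rewrite mulr_suml.
  by apply: eq_bigr => j _; rewrite -mulrBl expr_div_n.
rewrite ler_pdivrMr ?c2// -laplacian_formE// mulr2n.
by move: fL; rewrite ffE; lra.
Qed.

Lemma eigval2_laplacian_or_compl_ge (R : realType) (n : nat) (G : rel 'I_n) (e : R) :
  (1 < n)%N -> simple_graph G -> 0 < e -> e ^+ 3 * n%:R = 1 ->
  (1 - 32 * 384 * e <= eigval (laplacian R G) 2) ||
  (1 - 32 * 384 * e <= eigval (laplacian R (gcompl G)) 2).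
Proof.
move=> n_gt1 simpG e0 en.
have [symG irrG] := simpG.
have symH : symmetric (gcompl G) by move=> i j; rewrite /gcompl eq_sym symG.
have irrH : irreflexive (gcompl G) by move=> i; rewrite /gcompl eqxx.
have GH i j : i != j -> gcompl G i j = ~~ G i j by rewrite /gcompl => ->.
have HG i j : i != j -> G i j = ~~ gcompl G i j by move=> ij; rewrite GH// negbK.
have {}en : e ^+ 3 * #|'I_n|%:R = 1 by rewrite card_ord.
have [f [f0 f1 fG]] := algebraic_connectivity_test_vector R _ _ n_gt1 simpG.
have [g [g0 g1 gH]] := algebraic_connectivity_test_vector R _ _ n_gt1 (conj symH irrH).
move: (eigval _ _) (eigval (laplacian R G) _) fG gH => mu lam fG gH.
have [lam1|lam1] := leP 1 lam; first by apply/orP; left; lra.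
have [mu1|mu1] := leP 1 mu; first by apply/orP; right; lra.
have Gf : energy G f <= 2 by lra.
have Hg : energy (gcompl G) g <= 2 by lra.
(* If the large coordinate belongs to [f], the dichotomy is applied with [G] and its complement
   exchanged. *)
have [v [fv|gv]] := exists_large_coordinate _ _ _ _ _ _ GH f0 g0 f1 g1 Gf Hg.
  have [Hge|Gge] := energy_dichotomy _ _ _ _ _ _ _ _
    symH symG irrH irrG HG g0 f0 g1 f1 Hg Gf fv e0 en.
    by apply/orP; right; lra.
  by apply/orP; left; lra.
have [Gge|Hge] := energy_dichotomy _ _ _ _ _ _ _ _
  symG symH irrG irrH GH f0 g0 f1 g1 Gf Hg gv e0 en.
  by apply/orP; left; lra.
by apply/orP; right; lra.
Qed.

Theorem theorem2 :
  exists C : Rdefinitions.R, 0 < C /\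
    forall (n : nat) (G : rel 'I_n), (2 <= n)%N -> simple_graph G ->
      1 - C * (n%:R `^ (- (1 / 3))) <= Num.max (alg_conn G) (alg_conn (gcompl G)).
Proof.
(* Half of 64 * 384, because the energy is twice the Laplacian form. *)
exists (32 * 384); split; first by rewrite mulr_gt0.
move=> n G n_gt1 simpG.
have n0 : 0 < n%:R :> Rdefinitions.R by rewrite ltr0n (ltn_trans _ n_gt1).
(* Here e = n^(-1/3), and it remains to check e > 0 and e^3 n = 1. *)
rewrite le_max; apply: eigval2_laplacian_or_compl_ge => //; first by rewrite powR_gt0.
rewrite -powR_mulrn ?powR_ge0// -powRrM.
have -> : - (1 / 3) * 3 = -1 :> Rdefinitions.R by rewrite mulNr mul1r mulVf// pnatr_eq0.
by rewrite powRN powRr1 ?ltW// mulVf// gt_eqF.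
Qed.
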